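(* Let $J\colon\mathcal S_n\to\mathbb R$ be strictly isotone and let Assumption (A1) hold. Then problem (OF) and problem (CI) are equivalent in the following sense: $(\boldsymbol K_1^\ast,\boldsymbol K_2^\ast,\hat{\boldsymbol P}^\ast)\in\mathcal F_H$ is a solution of problem (OF) if and only if there exists a solution $\boldsymbol\alpha^\ast\colon\mathcal D_F\to[0,1]$ of problem (CI) such that $(\boldsymbol K_1^\ast,\boldsymbol K_2^\ast,\hat{\boldsymbol P}^\ast)=(\boldsymbol K_1^{\boldsymbol\alpha^\ast},\boldsymbol K_2^{\boldsymbol\alpha^\ast},\hat{\boldsymbol P}^{\boldsymbol\alpha^\ast})$.
   Context: $n,p_1,p_2$ are positive integers, $p_1,p_2\le n$, $H_1\in\mathbb R^{p_1\times n}$, $H_2\in\mathbb R^{p_2\times n}$, $H=\begin{pmatrix}H_1\\H_2\end{pmatrix}$. Assumption (A1): $\mathrm{rk}(H_1)=p_1$, $\mathrm{rk}(H_2)=p_2$, $\mathrm{rk}(H)=n$ (and the two input estimators $\hat x_1,\hat x_2$ are unbiased estimators of $H_1x_{\rm true}$, $H_2x_{\rm true}$; in the deterministic maps below only their values enter). $\mathcal S_m,\mathcal P_m,\mathcal P_m^\succ$: real symmetric, positive semi-definite, positive definite $m\times m$ matrices; $\preceq$ is the Löwner order. $\mathcal D_F:=\mathbb R^{p_1}\times\mathbb R^{p_2}\times\mathcal P_{p_1}^\succ\times\mathcal P_{p_2}^\succ$, with points denoted $(\hat x_1,\hat x_2,\hat P_1,\hat P_2)$. All statements about maps on $\mathcal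 D_F$ are read pointwise on $\mathcal D_F$. $J$ is strictly isotone if $A\preceq B$ implies $J(A)\le J(B)$ and ($A\preceq B$, $A\ne B$) implies $J(A)<J(B)$, for all $A,B\in\mathcal S_n$. $\mathcal F_H$ is the set of maps (linear fusion rules) $(\boldsymbol K_1,\boldsymbol K_2,\hat{\boldsymbol P})\colon\mathcal D_F\to\mathbb R^{n\times p_1}\times\mathbb R^{n\times p_2}\times\mathcal P_n^\succ$ that are unbiased, i.e. $\boldsymbol K_1H_1+\boldsymbol K_2H_2=I$ on $\mathcal D_F$, and preserve conservativeness on $\mathcal P_{p_1+p_2}^\succ$, i.e. for all $(\hat x_1,\hat x_2,\hat P_1,\hat P_2)\in\mathcal D_F$ and all $P_{\rm joint}=\begin{pmatrix}P_1&P_{12}\\P_{12}^\top&P_2\end{pmatrix}\in\mathcal P_{p_1+p_2}^\succ$ with $P_1\preceq\hat P_1$ and $P_2\preceq\hat P_2$ one has $\begin{pmatrix}\boldsymbol K_1&\boldsymbol K_2\end{pmatrix}P_{\rm joint}\begin{pmatrix}\boldsymbol K_1&\boldsymbol K_2\end{pmatrix}^\top\preceq\hat{\boldsymbol P}$. Problem (OF): minimize $J(\hat{\boldsymbol P})$ pointwise over $\mathcal F_H$; a solution is an element $(\boldsymbol K_1^\ast,\boldsymbol K_2^\ast,\hat{\boldsymbol P}^\ast)\in\mathcal F_H$ with $J(\hat{\boldsymbol P}^\ast)\le J(\hat{\boldsymbol P})$ at every point of $\mathcal D_F$ for every $(\boldsymbol K_1,\boldsymbol K_2,\hat{\boldsymbol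 P})\in\mathcal F_H$. Extend $J$ to $\bar J\colon\mathcal S_n\cup\{+\infty\}\to\mathbb R\cup\{+\infty\}$ by $\bar J(+\infty)=+\infty$ and $\bar J=J$ on $\mathcal S_n$, and set $P^{-1}:=+\infty$ for singular $P\in\mathcal P_n$. Problem (CI): a solution is a function $\boldsymbol\alpha^\ast\colon\mathcal D_F\to[0,1]$ such that at every point of $\mathcal D_F$ and for every function $\boldsymbol\alpha\colon\mathcal D_F\to[0,1]$, $\bar J((\boldsymbol\alpha^\ast H_1^\top\hat P_1^{-1}H_1+(1-\boldsymbol\alpha^\ast)H_2^\top\hat P_2^{-1}H_2)^{-1})\le\bar J((\boldsymbol\alpha H_1^\top\hat P_1^{-1}H_1+(1-\boldsymbol\alpha)H_2^\top\hat P_2^{-1}H_2)^{-1})$. For $\boldsymbol\alpha\colon\mathcal D_F\to[0,1]$ (wherever the matrix being inverted is non-singular): $\hat{\boldsymbol P}^{\boldsymbol\alpha}:=(\boldsymbol\alpha H_1^\top\hat P_1^{-1}H_1+(1-\boldsymbol\alpha)H_2^\top\hat P_2^{-1}H_2)^{-1}$, $\boldsymbol K_1^{\boldsymbol\alpha}:=\boldsymbol\alpha\hat{\boldsymbol P}^{\boldsymbol\alpha}H_1^\top\hat P_1^{-1}$, $\boldsymbol K_2^{\boldsymbol\alpha}:=(1-\boldsymbol\alpha)\hat{\boldsymbol P}^{\boldsymbol\alpha}H_2^\top\hat P_2^{-1}$. *)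

(* Defs.v *)
From mathcomp Require Export all_boot all_order all_algebra.
From mathcomp Require Export reals constructive_ereal.

Set Implicit Arguments.
Unset Strict Implicit.
Unset Printing Implicit Defensive.

Import Order.TTheory GRing.Theory Num.Theory.
Local Open Scope ring_scope.

Definition psd (R : realType) (m : nat) (A : 'M[R]_m) : Prop :=
  A \is symmetricmx /\ forall v : 'cV[R]_m, 0 <= (v^T *m A *m v) 0 0.

Definition posdef (R : realType) (m : nat) (A : 'M[R]_m) : Prop :=
  A \is symmetricmx /\
  forall v : 'cV[R]_m, v != 0 -> 0 < (v^T *m A *m v) 0 0.

(* Only used to compare symmetric matrices. *)
Definition loewner (R : realType) (m : nat) (A B : 'M[R]_m) : Prop :=
  psd (B - A).

(* A cost on symmetric matrices is represented by a function on all square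
   matrices; its values off the symmetric matrices are unconstrained here and
   are never used below. *)
Definition strictly_isotone (R : realType) (n : nat) (J : 'M[R]_n -> R) :
    Prop :=
  forall A B : 'M[R]_n, A \is symmetricmx -> B \is symmetricmx ->
    (loewner A B -> J A <= J B) /\
    (loewner A B -> A <> B -> J A < J B).

Record fusion_point (R : realType) (p1 p2 : nat) := FusionPoint {
  est1 : 'cV[R]_p1;
  est2 : 'cV[R]_p2;
  cov1 : 'M[R]_p1;
  cov2 : 'M[R]_p2;
  cov1_posdef : posdef cov1;
  cov2_posdef : posdef cov2 }.

(* The estimators themselves do not enter: only the rank conditions concern
   the deterministic maps considered here. *)
Definition rank_assumption (R : realType) (n p1 p2 : nat)
    (H1 : 'M[R]_(p1, n)) (H2 : 'M[R]_(p2, n)) : Prop :=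
  [/\ \rank H1 = p1, \rank H2 = p2 & \rank (col_mx H1 H2) = n].

Section Fusion.

Variables (R : realType) (n p1 p2 : nat).
Variables (H1 : 'M[R]_(p1, n)) (H2 : 'M[R]_(p2, n)).

Notation DF := (fusion_point R p1 p2).

Definition unbiased (K1 : DF -> 'M[R]_(n, p1)) (K2 : DF -> 'M[R]_(n, p2)) :
    Prop :=
  forall d : DF, K1 d *m H1 + K2 d *m H2 = 1%:M.

Definition preserves_conservativeness (K1 : DF -> 'M[R]_(n, p1))
    (K2 : DF -> 'M[R]_(n, p2)) (P : DF -> 'M[R]_n) : Prop :=
  forall (d : DF) (P1 : 'M[R]_p1) (P12 : 'M[R]_(p1, p2)) (P2 : 'M[R]_p2),
    let Pjoint := block_mx P1 P12 P12^T P2 in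
    posdef Pjoint -> loewner P1 (cov1 d) -> loewner P2 (cov2 d) ->
    loewner (row_mx (K1 d) (K2 d) *m Pjoint *m (row_mx (K1 d) (K2 d))^T) (P d).

Definition fusion_rule (K1 : DF -> 'M[R]_(n, p1))
    (K2 : DF -> 'M[R]_(n, p2)) (P : DF -> 'M[R]_n) : Prop :=
  [/\ forall d : DF, posdef (P d),
      unbiased K1 K2
    & preserves_conservativeness K1 K2 P].

Definition OF_solution (J : 'M[R]_n -> R) (K1 : DF -> 'M[R]_(n, p1))
    (K2 : DF -> 'M[R]_(n, p2)) (P : DF -> 'M[R]_n) : Prop :=
  fusion_rule K1 K2 P /\
  forall (K1' : DF -> 'M[R]_(n, p1)) (K2' : DF -> 'M[R]_(n, p2))
         (P' : DF -> 'M[R]_n),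
    fusion_rule K1' K2' P' -> forall d : DF, J (P d) <= J (P' d).

Definition CI_information (alpha : DF -> R) (d : DF) : 'M[R]_n :=
  alpha d *: (H1^T *m invmx (cov1 d) *m H1)
  + (1 - alpha d) *: (H2^T *m invmx (cov2 d) *m H2).

(* The inverse as an element of the symmetric matrices extended by +oo, the
   latter being [None]. *)
Definition ext_inv (A : 'M[R]_n) : option 'M[R]_n :=
  if A \in unitmx then Some (invmx A) else None.

Definition ext_cost (J : 'M[R]_n -> R) (X : option 'M[R]_n) : \bar R :=
  if X is Some A then (J A)%:E else +oo%E.

Definition unit_interval_valued (alpha : DF -> R) : Prop :=
  forall d : DF, 0 <= alpha d <= 1.

Definition CI_solution (J : 'M[R]_n -> R) (alpha : DF -> R) : Prop :=
  unit_interval_valued alpha /\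
  forall (d : DF) (beta : DF -> R), unit_interval_valued beta ->
    (ext_cost J (ext_inv (CI_information alpha d))
       <= ext_cost J (ext_inv (CI_information beta d)))%E.

(* Meaningful where [CI_information alpha d] is invertible ([invmx] is the
   identity on singular matrices). Under [rank_assumption] this holds at every
   point for a [CI_solution]: the weight 1/2 gives an invertible matrix, hence
   a finite cost. *)
Definition CI_bound (alpha : DF -> R) (d : DF) : 'M[R]_n :=
  invmx (CI_information alpha d).

Definition CI_gain1 (alpha : DF -> R) (d : DF) : 'M[R]_(n, p1) :=
  alpha d *: (CI_bound alpha d *m H1^T *m invmx (cov1 d)).

Definition CI_gain2 (alpha : DF -> R) (d : DF) : 'M[R]_(n, p2) :=
  (1 - alpha d) *: (CI_bound alpha d *m H2^T *m invmx (cov2 d)).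

End Fusion.

(* Main.v *)
Require Import Defs.
From mathcomp Require Import boolp classical_sets sesquilinear.
From mathcomp Require Import ring lra.
From mathcomp Require Import polyrcf.

(** A conservative unbiased fusion rule has, at every point, a bound at least as
    large as that of some covariance-intersection (CI) rule, and strictly larger
    unless it is that rule; conversely every CI rule with invertible information
    matrix is a conservative unbiased rule. The equivalence of the two
    optimization problems follows from these two facts, since the cost is strictly isotone.

    For the first fact fix a point, with covariance bounds C1 and C2 and gains
    K1 and K2, and put A = K1 C1 K1^T and B = K2 C2 K2^T. The least favourable
    correlation of the two errors in a direction u is nearly 1, so
    conservativeness gives
      (sqrt (u^T A u) + sqrt (u^T B u))^2 <= u^T P u    for all u
    (conservative_sqrt_le). The left-hand side is the infimum over x in (0, 1)
    of u^T A u / x + u^T B u / (1 - x), so that each u has an interval of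
    weights x that work for it. These intervals have a common point
    (uniform_weight): as in Helly's theorem on the line, it is enough that no
    weight x is too small for one direction and too large for another, and this
    holds because the directions for which x fails are, up to sign, connected
    by segments, along which the side of the failure cannot change (drift_sign).

    With one weight x for all directions, P >= A / x + B / (1 - x), which is the
    covariance of K1, K2 applied to uncorrelated errors with covariances C1 / x
    and C2 / (1 - x). By the Gauss-Markov theorem (gauss_markov) it is at least
    the inverse of x H1^T C1^-1 H1 + (1 - x) H2^T C2^-1 H2, with equality only
    for the CI gains (conservative_dominates_ci).

    For the second fact, the cross term of a joint covariance is bounded by its
    nonnegativity on the difference of the two inputs (ci_conservative). *)

Set Implicit Arguments.
Unset Strict Implicit.
Unset Printing Implicit Defensive.

Import Order.TTheory GRing.Theory Num.Theory.
Local Open Scope ring_scope.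

(** * Quadratic forms and definite matrices *)

Definition bil (R : realType) (m : nat) (A : 'M[R]_m) (u v : 'cV[R]_m) : R :=
  (u^T *m A *m v) 0 0.

Section BilinearForm.
Variables (R : realType) (m : nat).
Implicit Types (A B : 'M[R]_m) (u v w : 'cV[R]_m).

Lemma symmetricmxP A : reflect (A^T = A) (A \is symmetricmx).
Proof.
apply: (iffP (is_hermitianmxP _ _ _)).
  by rewrite expr0 scale1r map_mx_id // => {1}->; rewrite trmxK.
by move=> {1}<-; rewrite expr0 scale1r map_mx_id.
Qed.

Lemma bilDl A u v w : bil A (u + v) w = bil A u w + bil A v w.
Proof. by rewrite /bil linearD !mulmxDl mxE. Qed.

Lemma bilDr A u v w : bil A w (u + v) = bil A w u + bil A w v.
Proof. by rewrite /bil mulmxDr mxE. Qed.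

Lemma bilZl A c u v : bil A (c *: u) v = c * bil A u v.
Proof. by rewrite /bil linearZ /= -!scalemxAl mxE. Qed.

Lemma bilZr A c u v : bil A u (c *: v) = c * bil A u v.
Proof. by rewrite /bil -scalemxAr mxE. Qed.

Lemma bil0l A u : bil A 0 u = 0.
Proof. by rewrite /bil trmx0 !mul0mx mxE. Qed.

Lemma bil_mx0 u v : bil 0 u v = 0.
Proof. by rewrite /bil mulmx0 mul0mx mxE. Qed.

Lemma bil_addmx A B u v : bil (A + B) u v = bil A u v + bil B u v.
Proof. by rewrite /bil mulmxDr mulmxDl mxE. Qed.

Lemma bil_scalemx c A u v : bil (c *: A) u v = c * bil A u v.
Proof. by rewrite /bil -scalemxAr -scalemxAl mxE. Qed.

Lemma bil_oppmx A u v : bil (- A) u v = - bil A u v.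
Proof. by rewrite -scaleN1r bil_scalemx mulN1r. Qed.

Lemma bil_tr A u v : bil A^T u v = bil A v u.
Proof.
rewrite /bil -[(v^T *m _ *m _) 0 0]/((v^T *m A *m u) 0 0).
by rewrite -[X in _ = fun_of_matrix X _ _]trmxK [RHS]mxE !trmx_mul trmxK mulmxA.
Qed.

Lemma bil_congr k (K : 'M[R]_(k, m)) A (u v : 'cV[R]_k) :
  bil (K *m A *m K^T) u v = bil A (K^T *m u) (K^T *m v).
Proof. by rewrite /bil trmx_mul trmxK !mulmxA. Qed.

Definition bilE :=
  (bilDl, bilDr, bilZl, bilZr, bil_addmx, bil_scalemx, bil_oppmx).

End BilinearForm.

Section Definite.
Variable R : realType.

Lemma psd_intro m (A : 'M[R]_m) :
  A^T = A -> (forall v, 0 <= bil A v v) -> psd A.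
Proof. by move=> /symmetricmxP. Qed.

Lemma psd_tr m (A : 'M[R]_m) : psd A -> A^T = A.
Proof. by case=> /symmetricmxP. Qed.

Lemma psd_ge0 m (A : 'M[R]_m) v : psd A -> 0 <= bil A v v.
Proof. by case=> _ /(_ v). Qed.

Lemma posdef_intro m (A : 'M[R]_m) :
  A^T = A -> (forall v, v != 0 -> 0 < bil A v v) -> posdef A.
Proof. by move=> /symmetricmxP. Qed.

Lemma posdef_tr m (A : 'M[R]_m) : posdef A -> A^T = A.
Proof. by case=> /symmetricmxP. Qed.

Lemma posdef_gt0 m (A : 'M[R]_m) v : posdef A -> v != 0 -> 0 < bil A v v.
Proof. by case=> _ /(_ v). Qed.

Lemma posdef_psd m (A : 'M[R]_m) : posdef A -> psd A.
Proof.
move=> pdA; apply: psd_intro; first exact: posdef_tr.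
move=> v; have [->|v0] := eqVneq v 0; first by rewrite bil0l.
exact/ltW/posdef_gt0.
Qed.

Lemma psdD m (A B : 'M[R]_m) : psd A -> psd B -> psd (A + B).
Proof.
move=> pA pB; apply: psd_intro => [|v].
  by rewrite linearD /= !psd_tr.
by rewrite bilE addr_ge0 ?psd_ge0.
Qed.

Lemma psdZ m c (A : 'M[R]_m) : 0 <= c -> psd A -> psd (c *: A).
Proof.
move=> c0 pA; apply: psd_intro => [|v]; first by rewrite linearZ /= psd_tr.
by rewrite bilE mulr_ge0 ?psd_ge0.
Qed.

Lemma psd_congr m k (K : 'M[R]_(k, m)) (A : 'M[R]_m) :
  psd A -> psd (K *m A *m K^T).
Proof.
move=> pA; apply: psd_intro => [|v]; last by rewrite bil_congr psd_ge0.
by rewrite !trmx_mul trmxK psd_tr // mulmxA.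
Qed.

Lemma psd_anti m (A : 'M[R]_m) : psd A -> psd (- A) -> A = 0.
Proof.
move=> pA pN; have A0 v : bil A v v = 0.
  apply/eqP; rewrite eq_le psd_ge0 // andbT.
  by have := psd_ge0 v pN; rewrite bilE oppr_ge0.
apply/matrixP => i j; rewrite [RHS]mxE.
pose e i : 'cV[R]_m := delta_mx i 0.
have eE k l : bil A (e k) (e l) = A k l.
  by rewrite /bil trmx_delta -rowE -colE !mxE.
have := A0 (e i + e j); rewrite !bilE !A0 -(bil_tr A (e i)) psd_tr // !eE.
by lra.
Qed.

Lemma posdef_congr_eq0 m k (K : 'M[R]_(k, m)) (A : 'M[R]_m) :
  posdef A -> K *m A *m K^T = 0 -> K = 0.
Proof.
move=> pA KAK; apply/trmx_inj/matrixP => i j; rewrite trmx0 !mxE.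
have : K^T *m delta_mx j (0 : 'I_1) = 0.
  apply/eqP/negP => /negP /(posdef_gt0 pA).
  by rewrite -bil_congr KAK /bil mulmx0 mul0mx mxE ltxx.
by rewrite -colE => /matrixP/(_ i 0); rewrite !mxE.
Qed.

Lemma unitmx_ker0 m (A : 'M[R]_m) :
  (forall v : 'cV[R]_m, A *m v = 0 -> v = 0) -> A \in unitmx.
Proof.
move=> kerA; rewrite -unitmx_tr -row_free_unit -kermx_eq0.
apply/eqP/row_matrixP => i; rewrite row0; apply/trmx_inj; rewrite trmx0.
have kerAi : row i (kermx A^T) *m A^T = 0 by rewrite -row_mul mulmx_ker row0.
by apply: kerA; apply/trmx_inj; rewrite trmx_mul trmxK kerAi trmx0.
Qed.

Lemma posdef_unitmx m (A : 'M[R]_m) : posdef A -> A \in unitmx.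
Proof.
move=> pA; apply: unitmx_ker0 => v Av0; apply/eqP/negP => /negP.
by move=> /(posdef_gt0 pA); rewrite /bil -mulmxA Av0 mulmx0 mxE ltxx.
Qed.

Lemma posdef_invmx m (A : 'M[R]_m) : posdef A -> posdef (invmx A).
Proof.
move=> pA; have uA := posdef_unitmx pA.
apply: posdef_intro => [|v v0]; first by rewrite trmx_inv posdef_tr.
have -> : bil (invmx A) v v = bil A (invmx A *m v) (invmx A *m v).
  rewrite /bil trmx_mul trmx_inv posdef_tr // !mulmxA mulmxKV //.
apply: posdef_gt0 => //; apply: contra_neq v0 => iv0.
by rewrite -[v](mulKVmx uA) iv0 mulmx0.
Qed.

(** A may be singular, so either factor on the right can vanish; when both do,
    the signs of the form at u + v and u - v force bil A u v = 0. *)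
Lemma psd_cauchy_schwarz m (A : 'M[R]_m) u v :
  psd A -> bil A u v ^+ 2 <= bil A u u * bil A v v.
Proof.
move=> pA; have bC : bil A v u = bil A u v by rewrite -bil_tr psd_tr.
have := psd_ge0 (bil A v v *: u - bil A u v *: v) pA.
have := psd_ge0 (bil A u u *: v - bil A u v *: u) pA.
have := psd_ge0 (u + v) pA; have := psd_ge0 (u - v) pA.
rewrite -!scaleN1r !bilE bC.
have := psd_ge0 u pA; have := psd_ge0 v pA.
set a := bil A u u; set b := bil A v v; set c := bil A u v.
move=> b0 a0 h1 h2 h3 h4.
have {}h3 : 0 <= a * (a * b - c ^+ 2) by nra.
have {}h4 : 0 <= b * (a * b - c ^+ 2) by nra.
have [a_eq0|a_neq0] := eqVneq a 0; last first.
  by rewrite -subr_ge0; move: h3; rewrite pmulr_rge0 // lt_def a_neq0.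
have [b_eq0|b_neq0] := eqVneq b 0; last first.
  by rewrite -subr_ge0; move: h4; rewrite pmulr_rge0 // lt_def b_neq0.
have -> : c = 0 by lra.
by rewrite a_eq0 b_eq0 mul0r expr0n.
Qed.

Lemma psd_bil0_ker m (A : 'M[R]_m) v : psd A -> bil A v v = 0 -> A *m v = 0.
Proof.
move=> pA v0; apply/matrixP => i j; rewrite ord1 [RHS]mxE.
have := psd_cauchy_schwarz (delta_mx i 0) v pA.
rewrite v0 mulr0 /bil trmx_delta -mulmxA -rowE mxE => h.
by apply/eqP; rewrite -sqrf_eq0 eq_le h sqr_ge0.
Qed.

Lemma psd_unitmx_posdef m (A : 'M[R]_m) :
  psd A -> A \in unitmx -> posdef A.
Proof.
move=> pA uA; apply: posdef_intro => [|v v0]; first exact: psd_tr.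
rewrite lt_def psd_ge0 // andbT; apply: contra_neq v0 => /(psd_bil0_ker pA).
by move=> Av0; rewrite -[v](mulKmx uA) Av0 mulmx0.
Qed.

End Definite.

(** * A common weight for two quadratic forms *)

Lemma poly_neg_near (R : realType) (q : {poly R}) x : q.[x] < 0 ->
  exists2 e, 0 < e & forall y, `|y - x| < e -> q.[y] < 0.
Proof.
move=> qx; have [e e0 he] := @poly_cont R x q (- q.[x]) ltac:(lra).
by exists e => // y /he; rewrite ltr_norml => /andP[_]; lra.
Qed.

Section UniformWeight.
Variables (R : realType) (m : nat) (A B P : 'M[R]_m).
Hypotheses (psdA : psd A) (psdB : psd B) (symP : P^T = P).
Hypothesis sqrt_sum_le : forall u : 'cV[R]_m,
  bil A u u + bil B u u + 2 * Num.sqrt (bil A u u * bil B u u) <= bil P u u.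

(** For 0 < x < 1 positivity of gap x is P >= A / x + B / (1 - x); with the
    denominators cleared it stays meaningful at x = 0 and x = 1. *)
Definition gap (x : R) : 'M[R]_m :=
  (x * (1 - x)) *: P - (1 - x) *: A - x *: B.

(** Up to a positive factor, minus the derivative in x of
    u^T A u / x + u^T B u / (1 - x): its sign at a direction u tells on which
    side of x the best weight for u lies. *)
Definition drift (x : R) : 'M[R]_m := (1 - x) ^+ 2 *: A - x ^+ 2 *: B.

Lemma gap_tr (x : R) : (gap x)^T = gap x.
Proof. by rewrite /gap !linearD !linearN !linearZ /= symP !psd_tr. Qed.

(** A zero drift means that x is the best weight for the direction u, where
    a / x + b / (1 - x) takes its minimum (sqrt a + sqrt b)^2 <= p. *)
Lemma drift0_gap_ge0 (x : R) u : 0 <= x <= 1 -> bil (drift x) u u = 0 ->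
  0 <= bil (gap x) u u.
Proof.
move=> /andP[x0 x1]; rewrite /drift /gap !bilE; have := sqrt_sum_le u.
have := psd_ge0 u psdA; have := psd_ge0 u psdB.
set a := bil A u u; set b := bil B u u; set p := bil P u u => b0 a0 le_p d0.
have s0 := sqrtr_ge0 (a * b); have ss := sqr_sqrtr (mulr_ge0 a0 b0).
move: (Num.sqrt _) le_p s0 ss => s le_p s0 ss.
have ys : (1 - x) * s = x * b.
  apply/eqP; rewrite -(eqrXn2 (n := 2)) ?mulr_ge0 ?subr_ge0 //; apply/eqP.
  by have := congr1 (fun z => z * b) d0; rewrite mul0r !exprMn ss /=; lra.
have xs : x * s = (1 - x) * a.
  apply/eqP; rewrite -(eqrXn2 (n := 2)) ?mulr_ge0 ?subr_ge0 //; apply/eqP.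
  by have := congr1 (fun z => z * a) d0; rewrite mul0r !exprMn ss /=; lra.
have : 0 <= x * (1 - x) * (p - (a + b + 2 * s)).
  by rewrite !mulr_ge0 ?subr_ge0.
have : x * (1 - x) * s = x ^+ 2 * b by rewrite -mulrA ys; ring.
have : x * (1 - x) * s = (1 - x) ^+ 2 * a by rewrite mulrAC xs; ring.
by lra.
Qed.

(** If x fails for u and for v, replace v by - v to make the cross term of the
    gap nonpositive: x then fails on the whole segment from u to v. If u wanted
    a larger and v a smaller weight, the drift would vanish somewhere on that
    segment, and there x cannot fail. *)
Lemma drift_sign (x : R) u v : 0 <= x <= 1 ->
  bil (gap x) u u < 0 -> 0 < bil (drift x) u u ->
  bil (gap x) v v < 0 -> bil (drift x) v v < 0 -> False.
Proof.
move=> x01 gu du.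
wlog guv : v / bil (gap x) u v <= 0.
  move=> wlogv gv dv; have [guv|guv] := leP (bil (gap x) u v) 0.
    exact: (wlogv v).
  by apply: (wlogv (- v)); rewrite -[- v]scaleN1r !(bilZl, bilZr); lra.
move=> gv dv.
have gC : bil (gap x) v u = bil (gap x) u v by rewrite -bil_tr gap_tr.
pose c2 := bil (drift x) u u - (bil (drift x) u v + bil (drift x) v u)
           + bil (drift x) v v.
pose c1 := bil (drift x) u v + bil (drift x) v u - 2 * bil (drift x) u u.
pose q : {poly R} := - (c2 *: 'X^2 + c1 *: 'X + (bil (drift x) u u)%:P).
have qE t : q.[t] =
    - bil (drift x) ((1 - t) *: u + t *: v) ((1 - t) *: u + t *: v).
  by rewrite !hornerE !(bilDl, bilDr, bilZl, bilZr) /c1 /c2 /=; ring.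
have /(Num.Theory.poly_ivt ler01) [t /andP[t0 t1]] : q.[0] <= 0 <= q.[1].
  rewrite !qE !subr0 !subrr !scale1r !scale0r addr0 add0r.
  by rewrite oppr_le0 oppr_ge0 !ltW.
rewrite /root qE oppr_eq0 => /eqP /(drift0_gap_ge0 x01).
rewrite !(bilDl, bilDr, bilZl, bilZr) gC leNgt => /negP; apply.
have [->|tn1] := eqVneq t 1; first by lra.
have {tn1} t1' : 0 < 1 - t by rewrite subr_gt0 lt_neqAle tn1.
have h1 : (1 - t) ^+ 2 * bil (gap x) u u < 0 by rewrite pmulr_rlt0 // exprn_gt0.
have h2 : t * (1 - t) * bil (gap x) u v <= 0.
  by rewrite mulr_ge0_le0 // mulr_ge0 // ltW.
have h3 : t ^+ 2 * bil (gap x) v v <= 0 by rewrite mulr_ge0_le0 ?sqr_ge0 // ltW.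
by lra.
Qed.

(** Take the supremum of the weights that are too small for some direction. If
    it still failed for a direction u, then, both inequalities being open in x,
    either slightly larger weights would also be too small for u, or slightly
    smaller ones would be too large for u and too small for some v, against
    drift_sign. *)
Lemma uniform_weight : exists2 x : R, 0 <= x <= 1 & psd (gap x).
Proof.
(* The point 0 is put in by hand, so that E is nonempty; it is too large for
   no direction, since drift 0 = A is positive semidefinite. *)
pose E := [set x : R | 0 <= x <= 1 /\
  (x = 0 \/ exists2 u, bil (gap x) u u < 0 & 0 < bil (drift x) u u)]%classic.
have E0 : E 0 by split; [rewrite lexx ler01 | left].
have supE : has_sup E.
  by split; [exists 0 | exists 1 => x [/andP[]]].
have s01 : 0 <= sup E <= 1.
  apply/andP; split; first exact: sup_upper_bound.
  by apply: ge_sup; [exists 0 | move=> x [/andP[]]].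
exists (sup E) => //; apply: psd_intro => [|u]; first exact: gap_tr.
rewrite leNgt; apply/negP => gu.
pose a := bil A u u; pose b := bil B u u; pose p := bil P u u.
have a0 : 0 <= a by exact: psd_ge0.
have b0 : 0 <= b by exact: psd_ge0.
pose g : {poly R} := p *: ('X * (1 - 'X)) - a *: (1 - 'X) - b *: 'X.
pose d : {poly R} := a *: (1 - 'X) ^+ 2 - b *: 'X ^+ 2.
have gE y : g.[y] = bil (gap y) u u.
  by rewrite /gap !bilE !hornerE /= -/a -/b -/p; ring.
have dE y : d.[y] = bil (drift y) u u.
  by rewrite /drift !bilE !hornerE /= -/a -/b -/p; ring.
have [e e0 ge] : exists2 e, 0 < e & forall y, `|y - sup E| < e -> g.[y] < 0.
  by apply: poly_neg_near; rewrite gE.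
case: (ltrgtP (bil (drift (sup E)) u u) 0) => du; last first.
- by have := drift0_gap_ge0 s01 du; rewrite leNgt gu.
- have [e' e'0 de'] : exists2 e, 0 < e &
      forall y, `|y - sup E| < e -> (- d).[y] < 0.
    by apply: poly_neg_near; rewrite hornerN dE oppr_lt0.
  have s1 : sup E < 1.
    rewrite lt_neqAle; case/andP: s01 => _ ->; rewrite andbT.
    by apply: contraTneq du => ->; rewrite /drift !bilE -leNgt -/a -/b; lra.
  pose f := Num.min (1 - sup E) (Num.min e e') / 2.
  have m0 : 0 < Num.min (1 - sup E) (Num.min e e').
    by rewrite !lt_min e0 e'0 subr_gt0 s1.
  have f0 : 0 < f by rewrite divr_gt0.
  have : f < Num.min (1 - sup E) (Num.min e e') by rewrite /f; lra.
  rewrite !lt_min => /and3P[f1 fe fe'].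
  have near : `|sup E + f - sup E| = f.
    by rewrite addrAC subrr add0r gtr0_norm.
  suff /(sup_upper_bound supE) : E (sup E + f) by lra.
  split; first by case/andP: s01; lra.
  right; exists u; first by rewrite -gE ge // near.
  by rewrite -dE; have := de' (sup E + f); rewrite near hornerN oppr_lt0; exact.
- have [e' e'0 de'] : exists2 e, 0 < e &
      forall y, `|y - sup E| < e -> d.[y] < 0.
    by apply: poly_neg_near; rewrite dE.
  have m0 : 0 < Num.min e e' by rewrite lt_min e0.
  have [y Ey ylt] := sup_adherent m0 supE.
  have yle := sup_upper_bound supE Ey.
  have near : `|y - sup E| < Num.min e e' by rewrite ler0_norm; lra.
  move: near; rewrite lt_min => /andP[/ge gy /de' dy].
  case: Ey => y01 [y0|[v gv dv]].
    by move: dy; rewrite dE y0 /drift !bilE -/a -/b; lra.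
  by apply: (drift_sign y01 gv dv (v := u)); rewrite -?gE -?dE.
Qed.

End UniformWeight.

(** * The worst joint covariance *)

Section JointCovariance.
Variables (R : realType) (n p1 p2 : nat).

Lemma bil_block_sym (A : 'M[R]_p1) (B : 'M[R]_(p1, p2)) (D : 'M[R]_p2) x y :
  bil (block_mx A B B^T D) (col_mx x y) (col_mx x y) =
  bil A x x + 2 * (x^T *m B *m y) 0 0 + bil D y y.
Proof.
have flip : (y^T *m B^T *m x) 0 0 = (x^T *m B *m y) 0 0.
  by rewrite -[x^T *m B *m y]trmxK [RHS]mxE !trmx_mul trmxK mulmxA.
have addE (M N : 'M[R]_1) : (M + N) 0 0 = M 0 0 + N 0 0 by rewrite mxE.
rewrite /bil tr_col_mx mul_row_block mul_row_col !mulmxDl !addE flip; ring.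
Qed.

Lemma block_sym_tr (A : 'M[R]_p1) (B : 'M[R]_(p1, p2)) (D : 'M[R]_p2) :
  A^T = A -> D^T = D -> (block_mx A B B^T D)^T = block_mx A B B^T D.
Proof. by move=> sA sD; rewrite tr_block_mx trmxK sA sD. Qed.

Lemma bil_fused (K1 : 'M[R]_(n, p1)) (K2 : 'M[R]_(n, p2)) Q v :
  bil (row_mx K1 K2 *m Q *m (row_mx K1 K2)^T) v v =
  bil Q (col_mx (K1^T *m v) (K2^T *m v)) (col_mx (K1^T *m v) (K2^T *m v)).
Proof. by rewrite bil_congr tr_row_mx mul_col_mx. Qed.

(** The cross-covariance aligns the two errors along C1 x and C2 y with
    correlation c < 1; by Cauchy-Schwarz it costs at most a share c of the
    block-diagonal form. When x or y is zero the square root is zero, and so is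
    P12, by the convention for the inverse of zero. *)
Lemma worst_correlation_posdef (C1 : 'M[R]_p1) (C2 : 'M[R]_p2) x y c :
  posdef C1 -> posdef C2 -> 0 <= c < 1 ->
  let P12 := (c / Num.sqrt (bil C1 x x * bil C2 y y)) *:
               (C1 *m x *m y^T *m C2) in
  posdef (block_mx C1 P12 P12^T C2).
Proof.
move=> pC1 pC2 /andP[c0 c1] P12.
apply: posdef_intro; first by apply: block_sym_tr; exact: posdef_tr.
move=> v; rewrite -[v]vsubmxK; move: (usubmx v) (dsubmx v) => xi eta v0.
have -> : bil (block_mx C1 P12 P12^T C2) (col_mx xi eta) (col_mx xi eta) =
    bil C1 xi xi + bil C2 eta eta +
    2 * c * (bil C1 xi x * bil C2 y eta / Num.sqrt (bil C1 x x * bil C2 y y)).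
  rewrite bil_block_sym /P12 -scalemxAr -scalemxAl mxE.
  have -> : xi^T *m (C1 *m x *m y^T *m C2) *m eta =
      (xi^T *m C1 *m x) *m (y^T *m C2 *m eta) by rewrite !mulmxA.
  by rewrite mxE big_ord1 /bil; ring.
have X0 := psd_ge0 xi (posdef_psd pC1); have Y0 := psd_ge0 eta (posdef_psd pC2).
have : 0 < bil C1 xi xi + bil C2 eta eta.
  have [xi0|xi0] := eqVneq xi 0; last first.
    by apply: ltr_pwDl => //; exact: posdef_gt0.
  apply: ltr_wpDl => //; apply: posdef_gt0 => //.
  by apply: contra_neq v0 => ->; rewrite xi0 col_mx0.
have := psd_cauchy_schwarz xi x (posdef_psd pC1).
have := psd_cauchy_schwarz y eta (posdef_psd pC2).
have := psd_ge0 x (posdef_psd pC1); have := psd_ge0 y (posdef_psd pC2).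
move: X0 Y0; set X := bil C1 xi xi; set Y := bil C2 eta eta.
set a := bil C1 x x; set b := bil C2 y y.
set f := bil C1 xi x; set g := bil C2 y eta.
move=> X0 Y0 b0 a0 gle fle XY.
set r := _ / _.
have rle : r ^+ 2 <= X * Y.
  have [s0|s0] := eqVneq (Num.sqrt (a * b)) 0.
    by rewrite /r s0 invr0 mulr0 expr0n mulr_ge0.
  have ab0 : 0 < a * b by rewrite -sqrtr_gt0 lt_def s0 sqrtr_ge0.
  rewrite /r expr_div_n (sqr_sqrtr (ltW ab0)) ler_pdivrMr // exprMn.
  apply: le_trans (ler_pM (sqr_ge0 _) (sqr_ge0 _) fle gle) _.
  by rewrite le_eqVlt; apply/orP; left; apply/eqP; ring.
have rabs : 2 * `|r| <= X + Y.
  rewrite -ler_sqr ?nnegrE ?mulr_ge0 ?addr_ge0 // exprMn.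
  rewrite real_normK ?num_real //.
  by have := sqr_ge0 (X - Y); lra.
have : - `|r| <= r by rewrite lerNnormlW.
have : c * (2 * `|r|) <= c * (X + Y) by rewrite ler_wpM2l.
have : c * (X + Y) < 1 * (X + Y) by rewrite ltr_pM2r.
move=> h1 h2 h3; have : c * - `|r| <= c * r by rewrite ler_wpM2l.
by lra.
Qed.

Definition conservative (C1 : 'M[R]_p1) (C2 : 'M[R]_p2)
    (K1 : 'M[R]_(n, p1)) (K2 : 'M[R]_(n, p2)) (P : 'M[R]_n) : Prop :=
  forall P1 P12 P2, posdef (block_mx P1 P12 P12^T P2) ->
    loewner P1 C1 -> loewner P2 C2 ->
    loewner (row_mx K1 K2 *m block_mx P1 P12 P12^T P2 *m (row_mx K1 K2)^T) P.

(** A correlation c in the direction u adds 2 c sqrt (a b) to the fused variance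
    a + b of uncorrelated errors, and c may be taken arbitrarily close to 1. *)
Lemma conservative_sqrt_le (C1 : 'M[R]_p1) (C2 : 'M[R]_p2)
    (K1 : 'M[R]_(n, p1)) (K2 : 'M[R]_(n, p2)) (P : 'M[R]_n) :
  posdef C1 -> posdef C2 -> conservative C1 C2 K1 K2 P ->
  forall u, let a := bil (K1 *m C1 *m K1^T) u u in
    let b := bil (K2 *m C2 *m K2^T) u u in
    a + b + 2 * Num.sqrt (a * b) <= bil P u u.
Proof.
move=> pC1 pC2 cons u; rewrite !bil_congr /=.
set x := K1^T *m u; set y := K2^T *m u.
have refl m (C : 'M[R]_m) : loewner C C.
  rewrite /loewner subrr; apply: psd_intro => [|v]; first by rewrite trmx0.
  by rewrite /bil mulmx0 mul0mx mxE.
have bound c : 0 <= c < 1 ->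
    bil C1 x x + bil C2 y y + 2 * c * Num.sqrt (bil C1 x x * bil C2 y y) <=
    bil P u u.
  move=> c01.
  have pQ := worst_correlation_posdef x y pC1 pC2 c01.
  have := cons _ _ _ pQ (refl _ _) (refl _ _).
  move=> /(psd_ge0 u); rewrite bil_addmx bil_oppmx subr_ge0; apply: le_trans.
  rewrite bil_fused bil_block_sym -/x -/y -scalemxAr -scalemxAl mxE.
  have -> : x^T *m (C1 *m x *m y^T *m C2) *m y =
      (x^T *m C1 *m x) *m (y^T *m C2 *m y) by rewrite !mulmxA.
  rewrite mxE big_ord1 -/(bil C1 x x) -/(bil C2 y y).
  have := psd_ge0 x (posdef_psd pC1); have := psd_ge0 y (posdef_psd pC2).
  move: (bil C1 x x) (bil C2 y y) => a b b0 a0.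
  have [->|s0] := eqVneq (Num.sqrt (a * b)) 0; first by rewrite invr0; lra.
  have -> : c / Num.sqrt (a * b) * (a * b) = c * Num.sqrt (a * b).
    by rewrite -{2}(sqr_sqrtr (mulr_ge0 a0 b0)); field.
  by lra.
have h0 := bound 0; rewrite lexx ltr01 in h0; have {}h0 := h0 isT.
have s0 := sqrtr_ge0 (bil C1 x x * bil C2 y y).
move: (Num.sqrt _) s0 bound h0 => s s0 bound h0.
move: (bil C1 x x) (bil C2 y y) (bil P u u) bound h0 => a b p bound h0.
rewrite leNgt; apply/negP => lt_p.
have s_gt0 : 0 < s.
  by rewrite lt_def s0 andbT; apply: contraTneq lt_p => ->; lra.
(* The correlation q saturates the bound and is less than 1, so the midpoint
   of q and 1 violates it. *)
pose q := (p - a - b) / (2 * s).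
have qs : q * s = (p - a - b) / 2 by rewrite /q; field; rewrite gt_eqF.
have q0 : 0 <= q by rewrite divr_ge0 //; lra.
have q1 : q < 1 by rewrite ltr_pdivrMr ?mulr_gt0 //; lra.
have := bound ((q + 1) / 2).
have -> : 2 * ((q + 1) / 2) * s = q * s + s by field.
by rewrite qs => h; have := h ltac:(lra); lra.
Qed.

End JointCovariance.

(** * Optimal gains for a given weight *)

Section GaussMarkov.
Variables (R : realType) (n : nat).

Definition precision k (H : 'M[R]_(k, n)) (C : 'M[R]_k) : 'M[R]_n :=
  H^T *m invmx C *m H.

Definition gain k (x : R) (V : 'M[R]_n) (H : 'M[R]_(k, n)) (C : 'M[R]_k) :
    'M[R]_(n, k) :=
  x *: (V *m H^T *m invmx C).

Lemma precision_psd k (H : 'M[R]_(k, n)) C : posdef C -> psd (precision H C).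
Proof.
by move=> /posdef_invmx/posdef_psd/(psd_congr H^T); rewrite /precision trmxK.
Qed.

Lemma precision_bil0 k (H : 'M[R]_(k, n)) C v : posdef C ->
  bil (precision H C) v v = 0 -> H *m v = 0.
Proof.
move=> pC; have -> : precision H C = H^T *m invmx C *m H^T^T by rewrite trmxK.
rewrite bil_congr trmxK => h; apply/eqP; apply: contra_eqT h => Hv0.
by rewrite gt_eqF // posdef_gt0 //; exact: posdef_invmx.
Qed.

Lemma unweighted_gain_cov k (V : 'M[R]_n) (H : 'M[R]_(k, n)) C :
  posdef C -> V^T = V ->
  (V *m H^T *m invmx C) *m C *m (V *m H^T *m invmx C)^T =
  V *m precision H C *m V.
Proof.
move=> pC sV; rewrite mulmxKV ?posdef_unitmx // !trmx_mul trmxK sV.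
by rewrite trmx_inv (posdef_tr pC) /precision !mulmxA.
Qed.

(** One term of the Gauss-Markov identity: K is split into the gain of weight x
    and the deviation E, and the products with the gain are evaluated by
    C C^-1 = 1. The hypothesis on K makes the identity true at x = 0 too, where
    x^-1 = 0 and all terms vanish. *)
Lemma gain_decomposition k (x : R) (V : 'M[R]_n) (H : 'M[R]_(k, n)) C
    (K : 'M[R]_(n, k)) :
  posdef C -> V^T = V -> (x = 0 -> K = 0) ->
  let E := K - gain x V H C in
  x^-1 *: (K *m C *m K^T) =
  x^-1 *: (E *m C *m E^T) +
  (K *m H *m V + (K *m H *m V)^T - V *m (x *: precision H C) *m V).
Proof.
move=> pC sV K0 /=; have [x0|x0] := eqVneq x 0.
  rewrite K0 // x0 /gain !scale0r subrr !mul0mx !mulmx0 !mul0mx trmx0.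
  by rewrite invr0 !scale0r subr0 !addr0.
have LC : (V *m H^T *m invmx C) *m C = V *m H^T.
  by rewrite mulmxKV ?posdef_unitmx.
have CL : C *m (V *m H^T *m invmx C)^T = H *m V.
  have := congr1 trmx LC.
  by rewrite [LHS]trmx_mul (posdef_tr pC) [RHS]trmx_mul trmxK sV.
have := unweighted_gain_cov H pC sV.
rewrite /gain; set L := V *m H^T *m invmx C in LC CL *.
set X := precision H C => LCL.
have -> : (K - x *: L) *m C *m (K - x *: L)^T =
    K *m C *m K^T - x *: (K *m H *m V) - x *: (K *m H *m V)^T
    + x *: (x *: (V *m X *m V)).
  have -> : (K - x *: L)^T = K^T - x *: L^T by rewrite linearB linearZ.
  rewrite !mulmxBl !mulmxBr -!scalemxAl -!scalemxAr.
  have -> : (K *m H *m V)^T = V *m H^T *m K^T by rewrite !trmx_mul sV mulmxA.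
  by rewrite -LCL -[K *m C *m L^T]mulmxA CL mulmxA LC opprD opprK addrA.
rewrite -scalemxAr -scalemxAl.
move: (V *m X *m V) (K *m H *m V) (K *m C *m K^T) => W T S.
by apply/matrixP => i j; rewrite !mxE; field.
Qed.

End GaussMarkov.

(** * The fusion of two estimates at one point *)

Section Fused.
Variables (R : realType) (n p1 p2 : nat).
Variables (H1 : 'M[R]_(p1, n)) (H2 : 'M[R]_(p2, n)).
Variables (C1 : 'M[R]_p1) (C2 : 'M[R]_p2).
Hypotheses (pC1 : posdef C1) (pC2 : posdef C2).

Definition information (x : R) : 'M[R]_n :=
  x *: precision H1 C1 + (1 - x) *: precision H2 C2.

Lemma information_psd (x : R) : 0 <= x <= 1 -> psd (information x).
Proof.
move=> /andP[x0 x1].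
by apply: psdD; apply: psdZ; rewrite ?subr_ge0 //; exact: precision_psd.
Qed.

Lemma information_ker (x : R) (v : 'cV[R]_n) :
  0 <= x <= 1 -> information x *m v = 0 ->
  (x = 0 \/ H1 *m v = 0) /\ (1 - x = 0 \/ H2 *m v = 0).
Proof.
move=> /andP[x0 x1] Iv0.
have : bil (information x) v v = 0 by rewrite /bil -mulmxA Iv0 mulmx0 mxE.
have q1 := psd_ge0 v (precision_psd H1 pC1).
have q2 := psd_ge0 v (precision_psd H2 pC2).
rewrite bil_addmx !bil_scalemx => /eqP.
rewrite paddr_eq0 ?mulr_ge0 ?subr_ge0 // !mulf_eq0.
case/andP => /orP h1 /orP h2; split.
  by case: h1 => /eqP; [left | right; exact: precision_bil0 pC1 _].
by case: h2 => /eqP; [left | right; exact: precision_bil0 pC2 _].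
Qed.

Lemma information_posdef (x : R) : 0 <= x <= 1 -> information x \in unitmx ->
  posdef (information x).
Proof. by move=> /information_psd/psd_unitmx_posdef; exact. Qed.

Section Rule.
Variables (K1 : 'M[R]_(n, p1)) (K2 : 'M[R]_(n, p2)).
Hypothesis unbiasedK : K1 *m H1 + K2 *m H2 = 1%:M.

(** A kernel vector v of the information matrix is killed by each H whose
    weight is nonzero, and the gain of the other is zero: so
    v = K1 H1 v + K2 H2 v = 0. *)
Lemma information_unitmx (x : R) : 0 <= x <= 1 -> (x = 0 -> K1 = 0) ->
  (1 - x = 0 -> K2 = 0) -> information x \in unitmx.
Proof.
move=> x01 K10 K20; apply: unitmx_ker0 => v /(information_ker x01) [h1 h2].
rewrite -[v]mul1mx -unbiasedK mulmxDl.
have -> : K1 *m H1 *m v = 0.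
  by case: h1 => [/K10->|h]; rewrite ?mul0mx // -mulmxA h mulmx0.
case: h2 => [/K20->|h]; first by rewrite !mul0mx addr0.
by rewrite -mulmxA h mulmx0 addr0.
Qed.

(** Summing the decompositions of K1 and K2, unbiasedness turns the terms linear
    in K into 2 V, and V (information x) V = V is subtracted. *)
Lemma gauss_markov (x : R) : 0 <= x <= 1 -> (x = 0 -> K1 = 0) ->
  (1 - x = 0 -> K2 = 0) ->
  let V := invmx (information x) in
  let E1 := K1 - gain x V H1 C1 in let E2 := K2 - gain (1 - x) V H2 C2 in
  x^-1 *: (K1 *m C1 *m K1^T) + (1 - x)^-1 *: (K2 *m C2 *m K2^T) =
  x^-1 *: (E1 *m C1 *m E1^T) + (1 - x)^-1 *: (E2 *m C2 *m E2^T) + V.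
Proof.
move=> x01 K10 K20 /=; have uI := information_unitmx x01 K10 K20.
set V := invmx _.
have sV : V^T = V by exact/posdef_tr/posdef_invmx/information_posdef.
rewrite (gain_decomposition H1 pC1 sV K10).
rewrite (gain_decomposition H2 pC2 sV K20) /=.
rewrite addrACA; congr (_ + _).
have sumV : K1 *m H1 *m V + K2 *m H2 *m V = V.
  by rewrite -mulmxDl unbiasedK mul1mx.
have sumVT : (K1 *m H1 *m V)^T + (K2 *m H2 *m V)^T = V.
  by rewrite -linearD /= sumV.
have VIV : V *m (x *: precision H1 C1) *m V +
    V *m ((1 - x) *: precision H2 C2) *m V = V.
  by rewrite -mulmxDl -mulmxDr mulVmx // mul1mx.
by rewrite addrACA [X in X + _]addrACA sumV sumVT -opprD VIV addrK.
Qed.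

(** uniform_weight gives P >= A / x + B / (1 - x), where A and B are the fused
    variances of the two inputs, and gauss_markov bounds the right-hand side
    from below by the covariance-intersection bound, the excess vanishing
    only for the CI gains. At x = 0 (or 1) the gap forces A = 0 (or
    B = 0), hence a zero gain, and conservativeness for the other input alone
    remains. *)
Lemma conservative_dominates_ci (P : 'M[R]_n) : P^T = P ->
  conservative C1 C2 K1 K2 P ->
  exists x : R, [/\ 0 <= x <= 1, information x \in unitmx,
    loewner (invmx (information x)) P &
    P = invmx (information x) ->
      K1 = gain x (invmx (information x)) H1 C1 /\
      K2 = gain (1 - x) (invmx (information x)) H2 C2].
Proof.
move=> sP /(conservative_sqrt_le pC1 pC2) /= sqrt_le.
set A := K1 *m C1 *m K1^T in sqrt_le; set B := K2 *m C2 *m K2^T in sqrt_le.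
have pA : psd A by exact/psd_congr/posdef_psd.
have pB : psd B by exact/psd_congr/posdef_psd.
have [x x01 pG] := uniform_weight pA pB sP sqrt_le.
have /andP[x0 x1] := x01.
have K10 : x = 0 -> K1 = 0.
  move=> xE; apply: (posdef_congr_eq0 pC1); apply: psd_anti => //.
  by move: pG; rewrite /gap xE mul0r !scale0r !subr0 scale1r sub0r.
have K20 : 1 - x = 0 -> K2 = 0.
  move=> xE; apply: (posdef_congr_eq0 pC2); apply: psd_anti => //.
  have x_1 : x = 1 by lra.
  move: pG; rewrite /gap xE mulr0 !scale0r subr0 sub0r.
  by rewrite x_1 scale1r.
have dom : psd (P - (x^-1 *: A + (1 - x)^-1 *: B)).
  have [xE|xn0] := eqVneq x 0.
    have A0 : A = 0 by rewrite /A K10 // !mul0mx.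
    apply: psd_intro => [|u].
      by rewrite linearB linearD !linearZ /= sP !psd_tr.
    have := sqrt_le u; rewrite A0 xE invr0 subr0 invr1 !bilE.
    by rewrite bil_mx0 mul0r sqrtr0; lra.
  have [xE|xn1] := eqVneq (1 - x) 0.
    have B0 : B = 0 by rewrite /B K20 // !mul0mx.
    apply: psd_intro => [|u].
      by rewrite linearB linearD !linearZ /= sP !psd_tr.
    have := sqrt_le u.
    rewrite B0 (_ : x = 1) ?subrr ?invr0 ?invr1 ?bilE; last by lra.
    by rewrite bil_mx0 mulr0 sqrtr0; lra.
  have -> : P - (x^-1 *: A + (1 - x)^-1 *: B) = (x * (1 - x))^-1 *: gap A B P x.
    by apply/matrixP => i j; rewrite /gap !mxE; field; rewrite xn0 xn1.
  by apply: psdZ => //; rewrite invr_ge0 mulr_ge0 ?subr_ge0.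
have := gauss_markov x01 K10 K20; rewrite /= -/A -/B.
set V := invmx _ => gm; rewrite {}gm in dom.
set T1 := x^-1 *: _ in dom; set T2 := (1 - x)^-1 *: _ in dom.
have pT1 : psd T1.
  by apply: psdZ; [rewrite invr_ge0 | exact/psd_congr/posdef_psd].
have pT2 : psd T2.
  by apply: psdZ; [rewrite invr_ge0 subr_ge0 | exact/psd_congr/posdef_psd].
exists x; split => //; first exact: information_unitmx.
  rewrite /loewner -/V.
  have -> : P - V = P - (T1 + T2 + V) + (T1 + T2).
    by rewrite opprD [- (T1 + T2) - V]addrC [P + (- V - _)]addrA subrK.
  exact: (psdD dom (psdD pT1 pT2)).
move=> PV; have {}dom : psd (- (T1 + T2)).
  by move: dom; rewrite PV -/V [_ + V]addrC opprD addrA subrr add0r.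
have T12 : T1 + T2 = 0 by exact: (psd_anti (psdD pT1 pT2) dom).
have T10 : T1 = 0 by apply: psd_anti => //; rewrite (addr0_eq T12).
have T20 : T2 = 0 by move: T12; rewrite T10 add0r.
have gain_eq k (y : R) (H : 'M[R]_(k, n)) C K : posdef C -> (y = 0 -> K = 0) ->
    y^-1 *: ((K - gain y V H C) *m C *m (K - gain y V H C)^T) = 0 ->
    K = gain y V H C.
  move=> pC K0 /eqP; rewrite scaler_eq0 invr_eq0 => /orP[/eqP y0|/eqP E0].
    by rewrite K0 // /gain y0 scale0r.
  by apply/eqP; rewrite -subr_eq0; apply/eqP/(posdef_congr_eq0 pC).
by split; apply: gain_eq.
Qed.

End Rule.

Section CovarianceIntersection.
Variable x : R.
Hypotheses (x01 : 0 <= x <= 1) (uI : information x \in unitmx).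
Let V := invmx (information x).

Lemma ci_bound_posdef : posdef V.
Proof. exact/posdef_invmx/information_posdef. Qed.

Lemma ci_unbiased : gain x V H1 C1 *m H1 + gain (1 - x) V H2 C2 *m H2 = 1%:M.
Proof.
rewrite -(mulVmx uI) -/V /information mulmxDr -!scalemxAr /gain -!scalemxAl.
by rewrite /precision !mulmxA.
Qed.

(** With y = C1^-1 H1 V v and z = C2^-1 H2 V v, the fused variance along v is
    the joint form at the stacked pair (x y, (1 - x) z), and v^T V v is
    x y^T C1 y + (1 - x) z^T C2 z. The cross term is bounded by the joint form
    at (y, - z) being nonnegative, which avoids dividing by x or 1 - x. *)
Lemma ci_conservative :
  conservative C1 C2 (gain x V H1 C1) (gain (1 - x) V H2 C2) V.
Proof.
move=> P1 P12 P2 pQ le1 le2; have sV := posdef_tr ci_bound_posdef.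
apply: psd_intro => [|v].
  by rewrite linearB /= sV !trmx_mul trmxK (posdef_tr pQ) mulmxA.
rewrite bil_addmx bil_oppmx subr_ge0 bil_fused /gain !linearZ /= -!scalemxAl.
set L1 := V *m H1^T *m invmx C1; set L2 := V *m H2^T *m invmx C2.
have Vv : bil V v v =
    x * bil C1 (L1^T *m v) (L1^T *m v) +
    (1 - x) * bil C2 (L2^T *m v) (L2^T *m v).
  rewrite -!bil_congr !unweighted_gain_cov // -!bil_scalemx -bil_addmx.
  have -> : x *: (V *m precision H1 C1 *m V) +
      (1 - x) *: (V *m precision H2 C2 *m V) = V *m information x *m V.
    by rewrite /information mulmxDr mulmxDl -!scalemxAr -!scalemxAl.
  by rewrite mulVmx // mul1mx.
rewrite Vv; move: (L1^T *m v) (L2^T *m v) => y z.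
have := psd_ge0 y le1; have := psd_ge0 z le2.
have cross c d : ((c *: y)^T *m P12 *m (d *: z)) 0 0 =
    c * d * (y^T *m P12 *m z) 0 0.
  have -> : (c *: y)^T = c *: y^T by rewrite linearZ.
  by rewrite -!scalemxAl -scalemxAr scalerA mxE.
have := psd_ge0 (col_mx (1 *: y) (- 1 *: z)) (posdef_psd pQ).
rewrite !bil_block_sym !cross !bilE.
move: (bil P1 y y) (bil P2 z z) (bil C1 y y) (bil C2 z z) => a1 a2 c1 c2.
move: (fun_of_matrix _ 0 0) => r h h2 h1; have /andP[x0 x1] := x01.
have : 0 <= x * (1 - x) * (a1 - 2 * r + a2).
  by rewrite !mulr_ge0 ?subr_ge0 //; lra.
have : 0 <= x * (c1 - a1) by rewrite mulr_ge0.
have : 0 <= (1 - x) * (c2 - a2) by rewrite mulr_ge0 ?subr_ge0 // -subr_ge0.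
by lra.
Qed.

End CovarianceIntersection.

End Fused.

(** * Fusion rules and covariance intersection *)

Section Rules.
Variables (R : realType) (n p1 p2 : nat).
Variables (H1 : 'M[R]_(p1, n)) (H2 : 'M[R]_(p2, n)).
Notation DF := (fusion_point R p1 p2).

Lemma ci_fusion_rule (alpha : DF -> R) : unit_interval_valued alpha ->
  (forall d, CI_information H1 H2 alpha d \in unitmx) ->
  fusion_rule H1 H2 (CI_gain1 H1 H2 alpha) (CI_gain2 H1 H2 alpha)
    (CI_bound H1 H2 alpha).
Proof.
move=> a01 uI; split => [d|d|d P1 P12 P2 /=].
- exact: (ci_bound_posdef (cov1_posdef d) (cov2_posdef d) (a01 d) (uI d)).
- exact: (ci_unbiased (uI d)).
- exact: (ci_conservative (cov1_posdef d) (cov2_posdef d) (a01 d) (uI d)).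
Qed.

(** A left inverse of the stacked H1 and H2, which exists by the rank condition,
    provides unbiased gains, and neither weight is zero. *)
Lemma half_information_unitmx (C1 : 'M[R]_p1) (C2 : 'M[R]_p2) :
  rank_assumption H1 H2 -> posdef C1 -> posdef C2 ->
  information H1 H2 C1 C2 (2^-1) \in unitmx.
Proof.
have /andP[half0 half1] : 0 < (2^-1 : R) < 1 by lra.
move=> [_ _ rkH] pC1 pC2.
have /row_fullP[K KH] : row_full (col_mx H1 H2) by rewrite /row_full rkH.
apply: (information_unitmx pC1 pC2 (K1 := lsubmx K) (K2 := rsubmx K)).
- by rewrite -mul_row_col hsubmxK.
- by rewrite !ltW.
- by move=> h; rewrite h ltxx in half0.
- by move=> /subr0_eq h; rewrite -h ltxx in half1.
Qed.

Lemma fusion_rule_dominates_ci K1 K2 P (d : DF) : fusion_rule H1 H2 K1 K2 P ->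
  exists x : R, [/\ 0 <= x <= 1,
    information H1 H2 (cov1 d) (cov2 d) x \in unitmx,
    loewner (invmx (information H1 H2 (cov1 d) (cov2 d) x)) (P d) &
    P d = invmx (information H1 H2 (cov1 d) (cov2 d) x) ->
      K1 d = gain x (invmx (information H1 H2 (cov1 d) (cov2 d) x))
               H1 (cov1 d) /\
      K2 d = gain (1 - x) (invmx (information H1 H2 (cov1 d) (cov2 d) x))
               H2 (cov2 d)].
Proof.
move=> [pP unb cons].
apply: (conservative_dominates_ci (cov1_posdef d) (cov2_posdef d) (unb d)).
  exact: posdef_tr.
by move=> P1 P12 P2; exact: cons.
Qed.

Variable J : 'M[R]_n -> R.

(** The constant weight 1/2 has finite cost, so an optimal weight has, too. *)
Lemma ci_solution_unitmx (alpha : DF -> R) d : rank_assumption H1 H2 ->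
  CI_solution H1 H2 J alpha -> CI_information H1 H2 alpha d \in unitmx.
Proof.
move=> rk [_ opt].
have := opt d (fun=> 2^-1).
have half01 : 0 <= (2^-1 : R) <= 1 by lra.
move=> /(_ (fun=> half01)); rewrite /ext_inv.
have -> : CI_information H1 H2 (fun=> 2^-1) d \in unitmx.
  exact: half_information_unitmx (cov1_posdef d) (cov2_posdef d).
by case: ifP.
Qed.

Lemma ci_solution_optimal (alpha : DF -> R) : rank_assumption H1 H2 ->
  strictly_isotone J -> CI_solution H1 H2 J alpha ->
  OF_solution H1 H2 J (CI_gain1 H1 H2 alpha) (CI_gain2 H1 H2 alpha)
    (CI_bound H1 H2 alpha).
Proof.
move=> rk iso sol; have uI d := ci_solution_unitmx d rk sol.
case: (sol) => a01 opt; split; first exact: ci_fusion_rule.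
move=> K1 K2 P rule d.
have [x [x01 uIx le_P _]] := fusion_rule_dominates_ci d rule.
have /(opt d) : unit_interval_valued (fun _ : DF => x) by [].
rewrite /ext_inv uI.
have -> : CI_information H1 H2 (fun=> x) d \in unitmx by exact: uIx.
rewrite lee_fin => /le_trans; apply.
have [/(_ d)[symP _] _ _] := rule.
have [symV _] := ci_bound_posdef (cov1_posdef d) (cov2_posdef d) x01 uIx.
exact: (iso _ _ symV symP).1 le_P.
Qed.

(** The covariance-intersection rule built from the weights of
    fusion_rule_dominates_ci costs no more than P and, by strict isotonicity,
    costs less unless its bound is P; the gains then agree as well. Any
    competing weight gives a competing rule, hence a cost at least as large. *)
Lemma of_solution_is_ci K1 K2 P : strictly_isotone J ->
  OF_solution H1 H2 J K1 K2 P ->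
  exists alpha : DF -> R, CI_solution H1 H2 J alpha /\
    forall d : DF, [/\ K1 d = CI_gain1 H1 H2 alpha d,
      K2 d = CI_gain2 H1 H2 alpha d & P d = CI_bound H1 H2 alpha d].
Proof.
move=> iso [rule opt].
have [alpha halpha] := choice (fun d => fusion_rule_dominates_ci d rule).
have a01 : unit_interval_valued alpha by move=> d; case: (halpha d).
have uI d : CI_information H1 H2 alpha d \in unitmx by case: (halpha d).
have PE d : P d = CI_bound H1 H2 alpha d.
  have [_ _ le_P _] := halpha d; apply/eqP/negP => /negP /eqP ne.
  have := opt _ _ _ (ci_fusion_rule a01 uI) d; rewrite leNgt => /negP; apply.
  have [/(_ d)[symP _] _ _] := rule.
  have [symV _] :=
    ci_bound_posdef (cov1_posdef d) (cov2_posdef d) (a01 d) (uI d).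
  by apply: ((iso _ _ symV symP).2 le_P) => /esym.
exists alpha; split; last first.
  move=> d; have [_ _ _ /(_ (PE d)) [K1E K2E]] := halpha d.
  by split; [exact: K1E | exact: K2E | exact: PE].
split=> // d beta b01; rewrite /ext_inv uI.
case: ifP => [uB|_]; last exact: leey.
rewrite lee_fin -[invmx _]/(CI_bound H1 H2 alpha d) -PE.
(* A fusion rule must be defined at every point, so the competitor beta is
   replaced by alpha wherever its information matrix is singular. *)
pose gamma d' := if CI_information H1 H2 beta d' \in unitmx then beta d'
                 else alpha d'.
have gE d' : CI_information H1 H2 gamma d' =
    if CI_information H1 H2 beta d' \in unitmx
    then CI_information H1 H2 beta d' else CI_information H1 H2 alpha d'.
  by rewrite /CI_information /gamma; case: ifP.
have g01 : unit_interval_valued gamma by move=> d'; rewrite /gamma; case: ifP.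
have uG d' : CI_information H1 H2 gamma d' \in unitmx.
  by rewrite gE; case: ifP => // _; exact: uI.
have := opt _ _ _ (ci_fusion_rule g01 uG) d.
by rewrite /CI_bound gE uB.
Qed.

End Rules.

Theorem corollary25 (R : realType) (n p1 p2 : nat)
    (n_gt0 : (0 < n)%N) (p1_gt0 : (0 < p1)%N) (p2_gt0 : (0 < p2)%N)
    (p1_le_n : (p1 <= n)%N) (p2_le_n : (p2 <= n)%N)
    (H1 : 'M[R]_(p1, n)) (H2 : 'M[R]_(p2, n))
    (A1 : rank_assumption H1 H2)
    (J : 'M[R]_n -> R) (J_isotone : strictly_isotone J)
    (K1 : fusion_point R p1 p2 -> 'M[R]_(n, p1))
    (K2 : fusion_point R p1 p2 -> 'M[R]_(n, p2))
    (P : fusion_point R p1 p2 -> 'M[R]_n) :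
  OF_solution H1 H2 J K1 K2 P <->
  exists alpha : fusion_point R p1 p2 -> R,
    CI_solution H1 H2 J alpha /\
    forall d : fusion_point R p1 p2,
      [/\ K1 d = CI_gain1 H1 H2 alpha d,
          K2 d = CI_gain2 H1 H2 alpha d
        & P d = CI_bound H1 H2 alpha d].
Proof.
split; first exact: of_solution_is_ci.
move=> [alpha [sol E]].
have -> : K1 = CI_gain1 H1 H2 alpha by apply: funext => d; case: (E d).
have -> : K2 = CI_gain2 H1 H2 alpha by apply: funext => d; case: (E d).
have -> : P = CI_bound H1 H2 alpha by apply: funext => d; case: (E d).
exact: ci_solution_optimal.
Qed.
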